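(* Let $P$ be a program and let $B$ be a set of pattern rules that is correct w.r.t. $P$. Suppose that $\mathit{patunf}(P,B)$ contains a special pattern rule $r=(p,q)$. Then for all $n\in\mathbb N$ with $n\ge\alpha(r)$ and all $\theta\in S(\Sigma,X)$, there is an infinite $\Rightarrow_P$-chain that starts from $\langle p(n)\theta\rangle$.
   Context: Fix a signature $\Sigma$, a special constant $\mathsf{e}$ (also denoting the empty sequence), hole constants $\square_1,\square_2,\dots$ and an infinite countable set $X$ of variables, pairwise disjoint. $T(\Sigma,X)$ is the set of terms, $S(\Sigma,X)$ the set of substitutions; composition $x(\sigma\theta)=(x\sigma)\theta$, $\emptyset$ the identity, $\sigma^0=\emptyset$, $\sigma^{n+1}=\sigma^n\sigma$, $\mathsf{e}\theta=\mathsf{e}$; $\sigma$ commutes with $\theta$ if $x\sigma\theta=x\theta\sigma$ for all $x$. Renamings are bijective substitutions on $X$; $\mathit{mgu}$ denotes most general unifiers (componentwise on sequences). An $m$-context is a term over $\Sigma\cup\{\square_i\}$ and $X$ containing $\square_1,\dots,\square_m$ and no other hole; $c(s_1,\dots,s_m)$ replaces each $\square_i$ by $s_i$; for a 1-context $c$, $c^0=\square_1$, $c^{n+1}=c(c^n)$; $\chi^{(1)}$ is the set of 1-contexts without variables. Programs, rewriting: a program is a set of rules $(u,\bar v)$, $\bar v$ a finite sequence $\langle\dots\rangle$ of terms; binary rules are written $(u,v)$, $v\in T(\Sigma,X)\cup\{\mathsf{e}\}$. $[r]$ is the set of renamings of $r$, $[U]=\bigcup_{r\in U}[r]$; $\bar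 r\ll_S U$ means $\bar r$ is a sequence of elements of $U$ variable disjoint from $S$ and from each other. $\Rightarrow_r=\{(\langle s\rangle\bar s,(\bar v\bar s)\theta)\mid\langle(u,\bar v)\rangle\ll_{\langle s\rangle\bar s}[r],\theta\in\mathit{mgu}(u,s)\}$, $\Rightarrow_P=\bigcup_{r\in P}\Rightarrow_r$. $\mathit{id}$ is the set of rules $(\mathsf{f}(x_1,\dots,x_m),\mathsf{f}(x_1,\dots,x_m))$ with distinct $x_i$. $T_P^\beta(U)=[\{(u,\mathsf{e})\in P\}]\cup[\{(u\theta,v\theta)\mid (u,\langle v_1,\dots,v_m\rangle)=r\in P,\ 1\le i\le m,\ \langle(u_1,\mathsf{e}),\dots,(u_{i-1},\mathsf{e}),(u_i,v)\rangle\ll_r U\cup\mathit{id},\ v\ne\mathsf{e}\text{ if }i<m,\ \theta\in\mathit{mgu}(\langle u_1..u_i\rangle,\langle v_1..v_i\rangle)\}]$; $\mathit{binunf}(P)=\bigcup_n(T_P^\beta)^n(\emptyset)$. Patterns: a pattern substitution is $(\sigma,\mu)$ with $(\sigma,\mu)(n)=\sigma^n\mu$; a pattern term is $p=(s,(\sigma,\mu))$, $s\in T(\Sigma,X)\cup\{\mathsf{e}\}$, $p(n)=s\sigma^n\mu$, $\mathit{Var}(p)=\mathit{Var}(s)\cup\mathit{Var}(\sigma)\cup\mathit{Var}(\mu)$; $\widehat{s}=(s,(\emptyset,\emptyset))$. A pattern rule $r=(p,q)$ has $\mathit{rules}(r)=\{(p(n),q(n))\mid n\in\mathbb N\}$;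 it is correct w.r.t. $P$ if $\mathit{rules}(r)\subseteq\mathit{binunf}(P)$ (a set is correct if all elements are). A pattern substitution is an mgu of two sequences of pattern terms if its $n$-th instance is an mgu of the $n$-th instances for every $n$. $[r]=\{r'\mid\mathit{rules}(r')\subseteq[\mathit{rules}(r)]\}$ for pattern rules; $\mathit{patid}=\{(\widehat{\mathsf{f}(x_1..x_m)},\widehat{\mathsf{f}(x_1..x_m)})\}$. $T^\pi_{P,B}(U)=[B]\cup[\{((u,(\sigma,\mu)),(v,(\sigma_i\sigma,\mu_i\mu)))\mid r=(u,\langle v_1..v_m\rangle)\in P,\ 1\le i\le m,\ \langle(p_1,\widehat{\mathsf{e}}),\dots,(p_{i-1},\widehat{\mathsf{e}}),(p_i,(v,(\sigma_i,\mu_i)))\rangle\ll_r U\cup\mathit{patid},\ v\ne\mathsf{e}\text{ if }i<m,\ (\sigma,\mu)\text{ an mgu of }\langle p_1..p_i\rangle,\langle\widehat{v_1}..\widehat{v_i}\rangle,\ \sigma\text{ commutes with }\sigma_i,\mu_i\}]$; $\mathit{patunf}(P,B)=\bigcup_n(T^\pi_{P,B})^n(\emptyset)$. Simple patterns: $\Upsilon$ is a set of new unary symbols $c^{a,b}$ ($c\in\chi^{(1)}$, $a,b\in\mathbb N$); for $u\in T(\Sigma\cup\Upsilon,X)$, $u(n)$ replaces each $c^{a,b}$ by the nesting $c^{a\times n+b}$; $u\sim v$ iff $u(n)=v(n)$ for all $n$, $[u]$ its class. A pattern term $p=(s,(\sigma,\mu))$ is simple if for each $x\in\mathit{Var}(s)$,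 $\sigma(x)=c^a(x)$ and $\mu(x)=c^b(t)$ for some $c\in\chi^{(1)}$, $a,b\in\mathbb N$, $t\in T(\Sigma,X)$; then $\upsilon(p)=[s\theta_p]$ with $\theta_p(x)=\mu(x)$ if $\sigma(x)=x$ and $\theta_p(x)=c^{a,b}(t)$ otherwise. A pattern rule is simple if both components are. Special rules: a pattern rule $r=(p,q)$ is special if it is simple and there exist an $m$-context $c$ with $\mathit{Var}(c)=\emptyset$, $c_1,\dots,c_m\in\chi^{(1)}$, naturals $a_i,b_i,a'_i,b'_i$, terms $t_1,\dots,t_m\in T(\Sigma,X)$ and $\rho\in S(\Sigma,X)$ with $c(c_1^{a_1,b_1}(t_1),\dots,c_m^{a_m,b_m}(t_m))\in\upsilon(p)$ and $c(c_1^{a'_1,b'_1}(t_1\rho),\dots,c_m^{a'_m,b'_m}(t_m\rho))\in\upsilon(q)$ such that: (1) each $t_i$ is a variable or a ground term; (2) if $t_i\in X$ and $t_i=t_j$ then $c_i=c_j$; (3) $\{(a_i,a'_i)\mid t_i\text{ ground}\}=\{(h,h)\}$ for some $h>0$ and $\{(a_i,a'_i)\mid t_i\in X\}=\{(a,a')\}$ with $a\le a'$; (4) $\{(b_i,b'_i)\mid t_i\text{ ground}\}=\{(b,b')\}$ with $b\le b'$ and $\{(b_i,b'_i)\mid t_i\in X\}=\{(d,d')\}$; (5) $k=(b'-b)/h\in\mathbb N$, and $a=a'$ implies $0\le(d'-d)-a\times k$. Then $\alpha(r)=0$ if $a=a'$ and $\alpha(r)=\frac{a\times k-(d'-d)}{a'-a}$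 otherwise. *)

(* Defs.v *)
From HB Require Import structures.
From mathcomp Require Import all_boot all_order all_algebra.
From mathcomp Require Import boolp classical_sets.

Set Implicit Arguments.
Unset Strict Implicit.
Unset Printing Implicit Defensive.

Import Order.TTheory GRing.Theory Num.Theory.

Local Open Scope classical_set_scope.

Record signature := Signature { symb :> Type; arity : symb -> nat }.

(* Terms over [S] with leaves in [V]. The leaves are the variables for the
   elements of T(S, X), and the holes for contexts without variables. *)
Inductive term (S : signature) (V : Type) :=
| Var of V
| Fn (f : S) of {ffun 'I_(arity f) -> term S V}.
Arguments Var {S V} _.
Arguments Fn {S V} f _.

Fixpoint bind (S : signature) (V W : Type) (s : V -> term S W) (t : term S V)
    : term S W :=
  match t with
  | Var x => s x
  | Fn f ts => Fn f [ffun i => bind s (ts i)]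
  end.

Fixpoint occurs (S : signature) (V : eqType) (x : V) (t : term S V) : bool :=
  match t with
  | Var y => x == y
  | Fn f ts => [exists i, occurs x (ts i)]
  end.

Fixpoint fold_term (S : signature) (V A : Type) (var : V -> A)
    (op : forall f : S, {ffun 'I_(arity f) -> A} -> A) (t : term S V) : A :=
  match t with
  | Var x => var x
  | Fn f ts => op f [ffun i => fold_term var op (ts i)]
  end.

(* The variables X are the natural numbers. *)
Local Notation X := nat.

Section Defs.
Variable S : signature.

Notation tm := (term S X).

(* T(S, X) together with the constant e, which is [None]. *)
Definition eterm := option tm.

(* Since e also denotes the empty sequence, <e> is [::]. *)
Definition goal_of (s : eterm) : seq tm := if s is Some t then [:: t] else [::].

Definition var_term (t : tm) : set X := [set x | occurs x t].
Definition var_eterm (s : eterm) : set X :=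
  if s is Some t then var_term t else set0.
Definition var_seq (ts : seq tm) : set X := [set x | has (occurs x) ts].

Definition is_variable (t : tm) : Prop := exists x, t = Var x.
Definition is_ground (t : tm) : Prop := forall x, ~~ occurs x t.

Record subst := Subst {
  sfun :> X -> tm;
  sfun_fin : exists D : seq X, forall x, x \notin D -> sfun x = Var x }.

Definition app_subst (th : subst) (t : tm) : tm := bind th t.
Definition app_esubst (th : subst) (s : eterm) : eterm := omap (app_subst th) s.

Definition var_subst (th : subst) : set X :=
  [set x | exists2 y, th y <> Var y & x = y \/ occurs x (th y)].

Lemma subst_id_fin :
  exists D : seq X, forall x, x \notin D -> Var x = Var x :> tm.
Proof. by exists [::]. Qed.
Definition subst_id : subst := Subst subst_id_fin.

Lemma subst_comp_fin (sg th : subst) : exists D : seq X,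
  forall x, x \notin D -> app_subst th (sg x) = Var x.
Proof.
have [D1 H1] := sfun_fin sg; have [D2 H2] := sfun_fin th.
exists (D1 ++ D2) => x; rewrite mem_cat negb_or => /andP[/H1 -> /H2 Ex].
exact: Ex.
Qed.
(* Postfix order: [sg] is applied first. *)
Definition subst_comp (sg th : subst) : subst := Subst (subst_comp_fin sg th).

Fixpoint subst_pow (sg : subst) (n : nat) : subst :=
  if n is n'.+1 then subst_comp (subst_pow sg n') sg else subst_id.

Definition commutes (sg th : subst) : Prop :=
  forall x, app_subst th (sg x) = app_subst sg (th x).

Definition renaming (g : subst) : Prop :=
  exists2 f : X -> X, bijective f & forall x, g x = Var (f x).

Definition unifier (ss ts : seq eterm) (th : subst) : Prop :=
  map (app_esubst th) ss = map (app_esubst th) ts.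

Definition mgu (ss ts : seq eterm) : set subst :=
  [set th | unifier ss ts th /\
    forall eta, unifier ss ts eta ->
      exists d : subst, forall x, eta x = app_subst d (th x)].

(* [fresh var V U rs] is rs <<_V U, where [var] gives the variables of the
   elements of U. *)
Fixpoint fresh (A : Type) (var : A -> set X) (V : set X) (U : set A)
    (rs : seq A) : Prop :=
  if rs is r :: rs' then
    [/\ U r, var r `&` V = set0 & fresh var (V `|` var r) U rs']
  else True.

Definition rule : Type := tm * seq tm.
Definition program : Type := set rule.

Definition var_rule (r : rule) : set X := var_term r.1 `|` var_seq r.2.
Definition rename_rule (g : subst) (r : rule) : rule :=
  (app_subst g r.1, map (app_subst g) r.2).
Definition renamings_rule (r : rule) : set rule :=
  [set r' | exists2 g, renaming g & r' = rename_rule g r].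

Definition step_rule (r : rule) (g g' : seq tm) : Prop :=
  exists s ss u vs th,
    [/\ g = s :: ss,
        fresh var_rule (var_seq g) (renamings_rule r) [:: (u, vs)],
        mgu [:: Some u] [:: Some s] th
      & g' = map (app_subst th) (vs ++ ss)].

Definition step (P : program) (g g' : seq tm) : Prop :=
  exists2 r, P r & step_rule r g g'.

Definition infinite_chain (P : program) (g : seq tm) : Prop :=
  exists2 c : nat -> seq tm, c 0%N = g & forall i, step P (c i) (c i.+1).

(* Binary rules. The left-hand side ranges over [eterm] only so that the
   instances of an arbitrary pattern rule are binary rules; the elements of
   binunf(P) all have a term as left-hand side. *)
Definition brule : Type := eterm * eterm.

Definition var_brule (r : brule) : set X := var_eterm r.1 `|` var_eterm r.2.
Definition rename_brule (g : subst) (r : brule) : brule :=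
  (app_esubst g r.1, app_esubst g r.2).
Definition renamings (U : set brule) : set brule :=
  [set r' | exists2 r, U r & exists2 g, renaming g & r' = rename_brule g r].

Definition flat (f : S) (x : 'I_(arity f) -> X) : tm := Fn f [ffun i => Var (x i)].

Definition id_rules : set brule :=
  [set r | exists f (x : 'I_(arity f) -> X),
    injective x /\ r = (Some (flat x), Some (flat x))].

(* With i = (size us).+1, the selected rules are (u_j, e) for the elements u_j
   of [us], followed by (u_i, v). *)
Definition Tbeta (P : program) (U : set brule) : set brule :=
  renamings [set r | exists2 u, P (u, [::]) & r = (Some u, None)] `|`
  renamings [set r | exists u vs us ui v th,
    [/\ P (u, vs) /\ ((size us).+1 <= size vs)%N,
        fresh var_brule (var_rule (u, vs)) (U `|` id_rules)
          (rcons [seq (w, None) | w <- us] (ui, v)),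
        ((size us).+1 < size vs)%N -> v <> None,
        mgu (rcons us ui) (map Some (take (size us).+1 vs)) th
      & r = (Some (app_subst th u), app_esubst th v)]].

Definition binunf (P : program) : set brule :=
  \bigcup_n iter n (Tbeta P) set0.

Definition psubst : Type := subst * subst.
Definition psubst_inst (xi : psubst) (n : nat) : subst :=
  subst_comp (subst_pow xi.1 n) xi.2.

Definition pterm : Type := eterm * psubst.
Definition pterm_inst (p : pterm) (n : nat) : eterm :=
  app_esubst (psubst_inst p.2 n) p.1.
Definition var_pterm (p : pterm) : set X :=
  var_eterm p.1 `|` var_subst p.2.1 `|` var_subst p.2.2.
Definition hat (s : eterm) : pterm := (s, (subst_id, subst_id)).

Definition prule : Type := pterm * pterm.
Definition var_prule (r : prule) : set X := var_pterm r.1 `|` var_pterm r.2.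
Definition rules (r : prule) : set brule :=
  [set (pterm_inst r.1 n, pterm_inst r.2 n) | n in [set: nat]].

Definition correct (P : program) (r : prule) : Prop := rules r `<=` binunf P.
Definition correct_set (P : program) (B : set prule) : Prop :=
  forall r, B r -> correct P r.

Definition pmgu (ps qs : seq pterm) (xi : psubst) : Prop :=
  forall n, mgu [seq pterm_inst p n | p <- ps] [seq pterm_inst q n | q <- qs]
              (psubst_inst xi n).

Definition prenamings (U : set prule) : set prule :=
  [set r' | exists2 r, U r & rules r' `<=` renamings (rules r)].

Definition patid : set prule :=
  [set r | exists f (x : 'I_(arity f) -> X),
    injective x /\ r = (hat (Some (flat x)), hat (Some (flat x)))].

Definition Tpi (P : program) (B U : set prule) : set prule :=
  prenamings B `|`
  prenamings [set r | exists u vs ps pi v sgi mui sg mu,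
    [/\ P (u, vs) /\ ((size ps).+1 <= size vs)%N,
        fresh var_prule (var_rule (u, vs)) (U `|` patid)
          (rcons [seq (p, hat None) | p <- ps] (pi, (v, (sgi, mui)))),
        ((size ps).+1 < size vs)%N -> v <> None,
        pmgu (rcons ps pi)
          [seq hat (Some w) | w <- take (size ps).+1 vs] (sg, mu)
          /\ (commutes sg sgi /\ commutes sg mui)
      & r = ((Some u, (sg, mu)),
             (v, (subst_comp sgi sg, subst_comp mui mu)))]].

Definition patunf (P : program) (B : set prule) : set prule :=
  \bigcup_n iter n (Tpi P B) set0.

(* The m-contexts c with Var(c) = set0, the only ones used below: every leaf is
   one of the m holes (numbered from 0), and each of these occurs. *)
Definition gcontext (m : nat) : Type :=
  {c : term S 'I_m | [forall i : 'I_m, occurs i c]}.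

Definition fill (V : Type) (m : nat) (c : gcontext m) (s : 'I_m -> term S V)
    : term S V :=
  bind s (sval c).

Definition chi1 : Type := gcontext 1.

Fixpoint cpow (c : chi1) (n : nat) : term S 'I_1 :=
  if n is n'.+1 then fill c (fun=> cpow c n') else Var ord0.

Definition nest (c : chi1) (n : nat) (t : tm) : tm :=
  bind (fun=> t) (cpow c n).

(* The signature extended with the unary symbols c^{a,b}. *)
Definition usig : signature :=
  @Signature (S + chi1 * nat * nat)%type
    (fun f => match f with inl g => arity g | inr _ => 1%N end).

Notation utm := (term usig X).

Definition usymb (c : chi1) (a b : nat) (u : utm) : utm :=
  @Fn usig X (inr (c, a, b)) [ffun => u].

Definition embed (V : Type) : term S V -> term usig V :=
  fold_term Var (fun f ts => @Fn usig V (inl f) ts).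

Definition uinst_op (n : nat) (f : usig)
    : {ffun 'I_(@arity usig f) -> tm} -> tm :=
  match f with
  | inl g => fun ts => Fn g ts
  | inr (c, a, b) => fun ts => nest c (a * n + b) (ts ord0)
  end.

Definition uinst (u : utm) (n : nat) : tm := fold_term Var (uinst_op n) u.

Definition ueq (u v : utm) : Prop := forall n, uinst u n = uinst v n.

Definition simple_pterm (p : pterm) : Prop :=
  forall x, var_eterm p.1 x ->
    exists (c : chi1) (a b : nat) (t : tm),
      p.2.1 x = nest c a (Var x) /\ p.2.2 x = nest c b t.

Definition simple_prule (r : prule) : Prop :=
  simple_pterm r.1 /\ simple_pterm r.2.

(* [theta_of p th]: [th] is theta_p on Var(s). The c, a, b, t involved need not
   be unique, but the ~-class of s theta_p does not depend on them. *)
Definition theta_of (p : pterm) (th : X -> utm) : Prop :=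
  forall x, var_eterm p.1 x ->
    (p.2.1 x = Var x -> th x = embed (p.2.2 x)) /\
    (p.2.1 x <> Var x ->
      exists (c : chi1) (a b : nat) (t : tm),
        [/\ p.2.1 x = nest c a (Var x), p.2.2 x = nest c b t
          & th x = usymb c a b (embed t)]).

Definition upsilon (p : pterm) : set utm :=
  [set u | exists s th,
    [/\ p.1 = Some s, theta_of p th & ueq (bind th (embed s)) u]].

(* The witnesses that make [r] special. They need not be unique, nor need the
   value of [alpha] be, so [alpha] takes the witnesses as argument. *)
Record special (r : prule) : Type := Special {
  sp_m : nat;
  sp_c : gcontext sp_m;
  sp_ci : 'I_sp_m -> chi1;
  sp_ai : 'I_sp_m -> nat;
  sp_bi : 'I_sp_m -> nat;
  sp_ai' : 'I_sp_m -> nat;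
  sp_bi' : 'I_sp_m -> nat;
  sp_t : 'I_sp_m -> tm;
  sp_rho : subst;
  sp_h : nat;
  sp_a : nat;
  sp_a' : nat;
  sp_b : nat;
  sp_b' : nat;
  sp_d : nat;
  sp_d' : nat;
  sp_k : nat;
  sp_simple : simple_prule r;
  sp_left : upsilon r.1
    (bind (fun i => usymb (sp_ci i) (sp_ai i) (sp_bi i) (embed (sp_t i)))
       (embed (sval sp_c)));
  sp_right : upsilon r.2
    (bind (fun i => usymb (sp_ci i) (sp_ai' i) (sp_bi' i)
                      (embed (app_subst sp_rho (sp_t i))))
       (embed (sval sp_c)));
  sp_1 : forall i, is_variable (sp_t i) \/ is_ground (sp_t i);
  sp_2 : forall i j, is_variable (sp_t i) -> sp_t i = sp_t j ->
    sp_ci i = sp_ci j;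
  sp_3ground :
    [set (sp_ai i, sp_ai' i) | i in [set i | is_ground (sp_t i)]]
    = [set (sp_h, sp_h)];
  sp_3h : (0 < sp_h)%N;
  sp_3var :
    [set (sp_ai i, sp_ai' i) | i in [set i | is_variable (sp_t i)]]
    = [set (sp_a, sp_a')];
  sp_3a : (sp_a <= sp_a')%N;
  sp_4ground :
    [set (sp_bi i, sp_bi' i) | i in [set i | is_ground (sp_t i)]]
    = [set (sp_b, sp_b')];
  sp_4b : (sp_b <= sp_b')%N;
  sp_4var :
    [set (sp_bi i, sp_bi' i) | i in [set i | is_variable (sp_t i)]]
    = [set (sp_d, sp_d')];
  sp_5k : (sp_k%:R = (sp_b'%:R - sp_b%:R) / sp_h%:R :> rat)%R;
  sp_5d : sp_a = sp_a' ->
    (0 <= (sp_d'%:R - sp_d%:R) - sp_a%:R * sp_k%:R :> int)%R }.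

Definition alpha (r : prule) (w : special r) : rat :=
  if sp_a w == sp_a' w then 0%R
  else (((sp_a w)%:R * (sp_k w)%:R - ((sp_d' w)%:R - (sp_d w)%:R))
         / ((sp_a' w)%:R - (sp_a w)%:R))%R.

End Defs.

(* Main.v *)
(** Rewriting with arbitrary instances of program rules, instead of renamed rules
    and mgus, is closed under instantiation of the goal, so soundness of the
    unfoldings for it needs only that the substitutions involved are unifiers:
    if [(u, v)] is an instance of a rule of [patunf P B], then [u th] rewrites in at
    least one step to a goal with head [v th], for every [th]. For a special rule
    and [n >= alpha], condition (5) makes [q(n)] an instance of [p(n + k)]: the
    ground towers have equal heights, and the towers over variables in [q(n)] are
    at least as high. Hence [p(n) th] starts an infinite rewriting, which lifts to
    a [step]-chain because unifiable terms have an mgu. *)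

Require Import Defs.
From HB Require Import structures.
From mathcomp Require Import all_boot all_order all_algebra.
From mathcomp Require Import boolp classical_sets.
From mathcomp Require Import zify lra.

Set Implicit Arguments.
Unset Strict Implicit.
Unset Printing Implicit Defensive.

Import GRing.Theory Num.Theory.

(** * Induction, constructor injectivity and instantiation of terms *)

Lemma term_nested_ind (S : signature) (V : Type) (Q : term S V -> Prop) :
    (forall x, Q (Var x)) ->
    (forall (f : S) (ts : {ffun 'I_(arity f) -> term S V}),
       (forall i, Q (ts i)) -> Q (Fn f ts)) ->
  forall t, Q t.
Proof.
move=> QV QF; fix IH 1 => -[x|f ts]; first exact: QV.
by apply: QF => i; apply: IH.
Qed.

Lemma Fn_inj (S : signature) (V : Type) (f : S)
    (ts ss : {ffun 'I_(arity f) -> term S V}) : Fn f ts = Fn f ss -> ts = ss.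
Proof.
(* The arguments have a type depending on the head symbol, and [S] has no decidable equality. They
   are projected out by a classical test on the head and a transport; [ts] is the default value. *)
move=> E; pose proj (t : term S V) : {ffun 'I_(arity f) -> term S V} :=
  if t is Fn g us then
    if pselect (g = f) is left e then
      ecast z {ffun 'I_(arity z) -> term S V} e us
    else ts
  else ts.
have projE us : proj (Fn f us) = us.
  rewrite /proj; case: pselect => [e|/(_ erefl)[]].
  by rewrite (Prop_irrelevance e erefl).
by rewrite -(projE ts) E projE.
Qed.

Section Bind.
Variable S : signature.

Lemma eq_bind (V W : Type) (s1 s2 : V -> term S W) t :
  s1 =1 s2 -> bind s1 t = bind s2 t.
Proof.
move=> E; elim/term_nested_ind: t => [x|f ts IH] /=; first exact: E.
by congr Fn; apply/ffunP => i; rewrite !ffunE.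
Qed.

Lemma eq_in_bind (V : eqType) (W : Type) (s1 s2 : V -> term S W) t :
  (forall x, occurs x t -> s1 x = s2 x) -> bind s1 t = bind s2 t.
Proof.
elim/term_nested_ind: t => [x|f ts IH] /= E; first exact: E.
congr Fn; apply/ffunP => i; rewrite !ffunE; apply: IH => x xi.
by apply: E; apply/existsP; exists i.
Qed.

Lemma bind_bind (V W Z : Type) (s1 : V -> term S W) (s2 : W -> term S Z) t :
  bind s2 (bind s1 t) = bind (fun x => bind s2 (s1 x)) t.
Proof.
elim/term_nested_ind: t => [x|f ts IH] //=.
by congr Fn; apply/ffunP => i; rewrite !ffunE.
Qed.

Lemma bind_Var (V : Type) (t : term S V) : bind Var t = t.
Proof.
elim/term_nested_ind: t => [x|f ts IH] //=.
by congr Fn; apply/ffunP => i; rewrite !ffunE.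
Qed.

End Bind.

(** * Action of substitutions, and strict bounds on the variables of terms *)

Section Substitutions.
Variable S : signature.
Implicit Types (t u v : term S nat) (sg th : subst S).

Lemma app_comp sg th t :
  app_subst (subst_comp sg th) t = app_subst th (app_subst sg t).
Proof. by rewrite /app_subst bind_bind. Qed.

Lemma app_id t : app_subst (subst_id S) t = t.
Proof. exact: bind_Var. Qed.

Lemma app_esubst_comp sg th (s : eterm S) :
  app_esubst (subst_comp sg th) s = app_esubst th (app_esubst sg s).
Proof. by case: s => //= t; rewrite app_comp. Qed.

Lemma map_app_comp sg th (ts : seq (term S nat)) :
  map (app_subst (subst_comp sg th)) ts
  = map (app_subst th) (map (app_subst sg) ts).
Proof. by rewrite -map_comp; apply: eq_map => t /=; rewrite app_comp. Qed.

Lemma app_ground th t : is_ground t -> app_subst th t = t.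
Proof.
move=> gt; rewrite -[RHS]bind_Var; apply: eq_in_bind => x xt.
by move: (gt x); rewrite xt.
Qed.

Definition term_bound : term S nat -> nat :=
  fold_term succn (fun f ts => \max_i ts i).

Lemma term_bound_arg (f : S) (ts : {ffun 'I_(arity f) -> term S nat}) i :
  term_bound (ts i) <= term_bound (Fn f ts).
Proof.
have := @leq_bigmax _ (fun j => [ffun j => term_bound (ts j)] j) i.
by rewrite ffunE.
Qed.

Lemma occurs_bound x t : occurs x t -> x < term_bound t.
Proof.
elim/term_nested_ind: t => [y|f ts IH] /=; first by move/eqP ->.
case/existsP => i /IH /leq_trans; apply; exact: term_bound_arg.
Qed.

Definition seq_bound : seq (term S nat) -> nat :=
  foldr (fun t => maxn (term_bound t)) 0.

Lemma has_occurs_bound x ts : has (occurs x) ts -> x < seq_bound ts.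
Proof.
elim: ts => //= t ts IH; rewrite leq_max.
by case/orP => [/occurs_bound -> // | /IH ->]; rewrite orbT.
Qed.

Lemma eq_in_map_app sg th ts :
  (forall x, has (occurs x) ts -> sg x = th x) ->
  map (app_subst sg) ts = map (app_subst th) ts.
Proof.
elim: ts => //= t ts IH E; rewrite IH; last first.
  by move=> x xts; apply: E; rewrite xts orbT.
by congr cons; apply: eq_in_bind => x xt; apply: E; rewrite xt.
Qed.

End Substitutions.

(** * Existence of most general unifiers *)

Section Unification.
Variable S : signature.
Implicit Types (t u v : term S nat) (th eta : subst S).
Implicit Type E : seq (term S nat * term S nat).

Definition term_size : term S nat -> nat :=
  fold_term (fun=> 1) (fun f ts => (\sum_i ts i).+1).

Lemma term_size_Fn (f : S) (ts : {ffun 'I_(arity f) -> term S nat}) :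
  term_size (Fn f ts) = (\sum_i term_size (ts i)).+1.
Proof.
by rewrite /term_size /=; congr _.+1; apply: eq_bigr => i _; rewrite ffunE.
Qed.

Lemma term_size_gt0 t : 0 < term_size t.
Proof. by case: t => [x|f ts] //; rewrite term_size_Fn. Qed.

(** The occurs check: a proper subterm stays strictly smaller under any [th], so no substitution
    unifies [Var x] with a larger term containing [x]. *)
Lemma occurs_size x t th :
  occurs x t -> t = Var x \/ term_size (th x) < term_size (app_subst th t).
Proof.
elim/term_nested_ind: t => [y|f ts IH]; first by move=> /eqP ->; left.
case/existsP => i xi; right.
have -> : app_subst th (Fn f ts) = Fn f [ffun i => app_subst th (ts i)] by [].
rewrite term_size_Fn ltnS (bigD1 i) //= ffunE.
apply: leq_trans (leq_addr _ _).
by case: (IH i xi) => [->|/ltnW].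
Qed.

Fixpoint solves E th : Prop :=
  if E is (u, v) :: E' then app_subst th u = app_subst th v /\ solves E' th
  else True.

Lemma solves_cat E1 E2 th : solves (E1 ++ E2) th <-> solves E1 th /\ solves E2 th.
Proof. by elim: E1 => [|[u v] E1 IH] /=; tauto. Qed.

Lemma solves_map (I : eqType) (f g : I -> term S nat) (s : seq I) th :
  solves [seq (f i, g i) | i <- s] th <->
  {in s, forall i, app_subst th (f i) = app_subst th (g i)}.
Proof.
elim: s => [|j s [IH1 IH2]] /=; first by [].
split=> [[Ej /IH1 Es] i|H].
  by rewrite inE => /orP[/eqP ->|/Es].
split; first by apply: H; rewrite mem_head.
by apply: IH2 => i si; apply: H; rewrite inE si orbT.
Qed.

(** Stated for a set of solutions, so that it transfers between equation systems with the same
    solutions. *)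
Definition has_mgu (U : subst S -> Prop) : Prop :=
  exists2 th, U th &
    forall eta, U eta -> exists d : subst S, forall x, eta x = app_subst d (th x).

Lemma has_mgu_iff (U U' : subst S -> Prop) :
  (forall th, U th <-> U' th) -> has_mgu U -> has_mgu U'.
Proof.
move=> UU' [th Uth th_mg]; exists th; first exact/UU'.
by move=> eta /UU'; apply: th_mg.
Qed.

Lemma subst1_fin x t :
  exists D : seq nat, forall y, y \notin D -> (if y == x then t else Var y) = Var y.
Proof. by exists [:: x] => y; rewrite inE => /negPf ->. Qed.
Definition subst1 x t : subst S := Subst (subst1_fin x t).

Lemma app_subst1_notin x t u : ~~ occurs x u -> app_subst (subst1 x t) u = u.
Proof.
move=> xu; rewrite -[RHS]bind_Var; apply: eq_in_bind => y yu /=.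
by case: eqP => // yx; rewrite -yx yu in xu.
Qed.

(** A solution [eta] of the equation [x = t] is unchanged when preceded by the binding of [x] to
    [t]. *)
Lemma app_subst1_absorb x t eta u :
  eta x = app_subst eta t -> app_subst eta (app_subst (subst1 x t) u) = app_subst eta u.
Proof.
move=> E; rewrite /app_subst bind_bind; apply: eq_bind => y /=.
by case: eqP => // ->.
Qed.

Definition app_eqs th E := [seq (app_subst th e.1, app_subst th e.2) | e <- E].

Lemma solves_app_eqs sg E th :
  solves (app_eqs sg E) th <-> solves E (subst_comp sg th).
Proof. by elim: E => [|[u v] E IH] //=; rewrite !app_comp IH. Qed.

Lemma solves_ext E th eta : th =1 eta -> solves E th -> solves E eta.
Proof.
move=> e; elim: E => [|[u v] E IH] //= [Euv /IH]; split=> //.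
by rewrite /app_subst -!(eq_bind _ e).
Qed.

Lemma solves_app_subst1 x t E eta :
  eta x = app_subst eta t -> solves (app_eqs (subst1 x t) E) eta <-> solves E eta.
Proof.
move=> E1; rewrite solves_app_eqs.
have e y : subst_comp (subst1 x t) eta y = eta y.
  exact: (app_subst1_absorb (Var y) E1).
by split; apply: solves_ext => y; rewrite e.
Qed.

(** Variable elimination: the mgu is the binding of [x] to [t] followed by an mgu of the remaining
    equations. It is most general because every solution absorbs the binding. *)
Lemma has_mgu_elim x t E : ~~ occurs x t ->
  has_mgu (solves (app_eqs (subst1 x t) E)) -> has_mgu (solves ((Var x, t) :: E)).
Proof.
move=> xt [th /solves_app_eqs Uth th_mg].
exists (subst_comp (subst1 x t) th).
  by split=> //; rewrite !app_comp (app_subst1_notin t xt) /app_subst /= eqxx.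
move=> eta [/= E1 UE]; have [d dE] := th_mg eta ((solves_app_subst1 E E1).2 UE).
exists d => y; rewrite -[LHS](app_subst1_absorb (Var y) E1).
by rewrite /app_subst /= bind_bind; apply: eq_bind.
Qed.

Definition eqs_size eta E := \sum_(e <- E) term_size (app_subst eta e.1).

Lemma eqs_size_app_subst1 x t E eta : eta x = app_subst eta t ->
  eqs_size eta (app_eqs (subst1 x t) E) = eqs_size eta E.
Proof.
move=> E1; rewrite /eqs_size big_map; apply: eq_bigr => e _ /=.
by rewrite app_subst1_absorb.
Qed.

(* Every transformation step strictly decreases the total size of the equations
   instantiated by a fixed solution [eta], so variables need not be counted. *)
Lemma solvable_has_mgu eta E : solves E eta -> has_mgu (solves E).
Proof.
move: {2}(eqs_size eta E).+1 (ltnSn (eqs_size eta E)) => n.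
elim: n E => // n IH [|[u v] E] leE.
  move=> _; exists (subst_id S) => // th _; exists th => x //.
case=> Euv UE.
have elim_var x t : eta x = app_subst eta t ->
    eqs_size eta E < n -> has_mgu (solves ((Var x, t) :: E)).
  move=> E1 ltE; have [xt|xt] := boolP (occurs x t); last first.
    apply: has_mgu_elim => //; apply: IH; first by rewrite eqs_size_app_subst1.
    by rewrite solves_app_subst1.
  (* Since [eta] solves the equation, the occurs check leaves only the trivial equation [x = x],
     which is dropped. *)
  case: (occurs_size eta xt) => [->|]; last by rewrite -E1 ltnn.
  by apply: (has_mgu_iff _ (IH E ltE UE)) => th /=; split=> // -[].
have ltE : eqs_size eta E < n.
  move: leE; rewrite /eqs_size big_cons /= => leE.
  by have := term_size_gt0 (app_subst eta u); lia.
case: u v Euv leE => [x|f ts] [y|g ss] Euv leE.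
- exact: elim_var.
- exact: elim_var.
- have := elim_var _ _ (esym Euv) ltE; apply: has_mgu_iff => th /=.
  by split=> -[-> ?].
have efg : f = g by case: Euv.
subst g.
(* Decomposition: the equation is replaced by those between the arguments, and the size drops by the
   head symbol. *)
pose E' := [seq (ts i, ss i) | i <- enum 'I_(arity f)] ++ E.
have solvesE' th : solves E' th <-> solves ((Fn f ts, Fn f ss) :: E) th.
  rewrite solves_cat solves_map /=; split=> -[Es ?]; split=> //.
    by congr Fn; apply/ffunP => i; rewrite !ffunE; apply: Es; rewrite mem_enum.
  move=> i _; move/Fn_inj/ffunP: Es => /(_ i); rewrite !ffunE; exact.
apply: (has_mgu_iff solvesE'); apply: IH; last exact/solvesE'.
move: leE; rewrite /eqs_size big_cons big_cat /= big_map big_enum /=.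
have -> : app_subst eta (Fn f ts) = Fn f [ffun i => app_subst eta (ts i)] by [].
rewrite term_size_Fn; under eq_bigr do rewrite ffunE.
by rewrite addSn ltnS.
Qed.

Lemma mgu_exists u v eta : app_subst eta u = app_subst eta v ->
  exists th, mgu [:: Some u] [:: Some v] th.
Proof.
move=> Euv; have [th [Eth _] th_mg] := @solvable_has_mgu eta [:: (u, v)] (conj Euv I).
exists th; split; first by rewrite /unifier /= Eth.
by move=> eta' [Eeta']; apply: th_mg.
Qed.

End Unification.

(** * Matching steps and their lifting *)

Section Lifting.
Variables (S : signature) (P : program S).
Implicit Types (g : seq (term S nat)) (sg th : subst S).

(* Rewriting with arbitrary instances of program rules. Unlike [step], it is
   closed under instantiation of the goal. *)
Definition mstep g g' : Prop :=
  exists u vs sg ss,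
    [/\ P (u, vs), g = app_subst sg u :: ss & g' = map (app_subst sg) vs ++ ss].

Inductive msteps g : seq (term S nat) -> Prop :=
| msteps_refl : msteps g g
| msteps_step g1 g2 : mstep g g1 -> msteps g1 g2 -> msteps g g2.

Lemma msteps_trans g1 g2 g3 : msteps g1 g2 -> msteps g2 g3 -> msteps g1 g3.
Proof.
move=> H; elim: H g3 => // {}g1 g g' s1 _ IH g3 /IH; exact: msteps_step.
Qed.

Lemma msteps_inv g g' : msteps g g' ->
  g = g' \/ exists2 g1, mstep g g1 & msteps g1 g'.
Proof. by case=> [|g1 g2 s1 s2]; [left | right; exists g1]. Qed.

(** Exchanging the blocks [[0, N)] and [[N, 2N)] moves all variables below [N] away and, unlike a
    shift by [N], is a bijection of finite support. *)
Definition swap_below N x :=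
  if x < N then x + N else if x < N + N then x - N else x.

Lemma swap_belowK N : involutive (swap_below N).
Proof. by move=> x; rewrite /swap_below; do ?[case: ifP] => *; lia. Qed.

Lemma swap_subst_fin N : exists D : seq nat,
  forall x, x \notin D -> Var (swap_below N x) = Var x :> term S nat.
Proof.
exists (iota 0 (N + N)) => x; rewrite mem_iota /swap_below => xD.
by congr Var; do ?[case: ifP] => *; lia.
Qed.
Definition swap_subst N : subst S := Subst (swap_subst_fin N).

Lemma swap_subst_renaming N : renaming (swap_subst N).
Proof.
by exists (swap_below N) => //; exists (swap_below N); apply: swap_belowK.
Qed.

Lemma glue_fin N th sg : exists D : seq nat, forall x, x \notin D ->
  (if x < N then th x else if x < N + N then sg (x - N) else Var x) = Var x.
Proof.
exists (iota 0 (N + N)) => x; rewrite mem_iota => xD.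
by rewrite !ifN //; lia.
Qed.
(** Acts as [th] on the variables of the goal and, through the swap, as [sg] on those of the renamed
    rule. *)
Definition glue N th sg : subst S := Subst (glue_fin N th sg).

Lemma glue_swap N th sg x : x < N -> app_subst (glue N th sg) (swap_subst N x) = sg x.
Proof.
by move=> xN; rewrite /app_subst /= /swap_below xN ltnNge leq_addl /= ltn_add2r xN addnK.
Qed.

Lemma occurs_swap N x t : term_bound t <= N ->
  occurs x (app_subst (swap_subst N) t) -> N <= x.
Proof.
elim/term_nested_ind: t => [y|f ts IH] /= leN.
  by rewrite /swap_below leN => /eqP ->; rewrite leq_addl.
case/existsP => i; rewrite ffunE; apply: IH.
exact: leq_trans (term_bound_arg ts i) leN.
Qed.

Lemma has_occurs_swap N x ts : seq_bound ts <= N ->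
  has (occurs x) (map (app_subst (swap_subst N)) ts) -> N <= x.
Proof.
elim: ts => //= t ts IH; rewrite geq_max => /andP[tN tsN].
by case/orP; [apply: occurs_swap | apply: IH].
Qed.

(** The lifting lemma: once the rule is renamed apart, [eta] and the matcher [sg] glue into a
    unifier of its head with the selected term. An mgu therefore exists, and the glued substitution
    factors through it by the required [d]. *)
Lemma lift_mstep g eta g' : mstep (map (app_subst eta) g) g' ->
  exists g1 d, step P g g1 /\ map (app_subst d) g1 = g'.
Proof.
case=> u [vs] [sg] [ss] [Pr Eg ->{g'}].
case: g Eg => [//|s0 ss0] [Es0 <-{ss}].
pose N := maxn (seq_bound (s0 :: ss0)) (maxn (term_bound u) (seq_bound vs)).
pose u' := app_subst (swap_subst N) u.
pose vs' := map (app_subst (swap_subst N)) vs.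
pose dl := glue N eta sg.
have gN : seq_bound (s0 :: ss0) <= N by rewrite leq_maxl.
have uN : term_bound u <= N by rewrite /N; lia.
have vN : seq_bound vs <= N by rewrite /N; lia.
have dl_u : app_subst dl u' = app_subst sg u.
  rewrite /u' -app_comp; apply: eq_in_bind => x /occurs_bound xu.
  by apply: glue_swap; apply: leq_trans uN.
have dl_vs : map (app_subst dl) vs' = map (app_subst sg) vs.
  rewrite /vs' -map_app_comp; apply: eq_in_map_app => x /has_occurs_bound xu.
  by apply: glue_swap; apply: leq_trans vN.
have dl_g : map (app_subst dl) (s0 :: ss0) = map (app_subst eta) (s0 :: ss0).
  apply: eq_in_map_app => x /has_occurs_bound /leq_trans /(_ gN) xN.
  by rewrite /= xN.
case: dl_g => dl_s0 dl_ss0.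
have Eu : app_subst dl u' = app_subst dl s0 by rewrite dl_u dl_s0.
have [th mgu_th] := mgu_exists Eu.
have [|d dE] := mgu_th.2 dl; first by rewrite /unifier /= Eu.
exists (map (app_subst th) (vs' ++ ss0)), d; split; last first.
  rewrite -map_app_comp -dl_vs -dl_ss0 -map_cat.
  by apply: eq_in_map_app => x _; rewrite dE.
exists (u, vs) => //; exists s0, ss0, u', vs', th; split=> //; split=> //.
  by exists (swap_subst N) => //; apply: swap_subst_renaming.
(* The variables of the goal lie below [N], those of the renamed rule do not. *)
rewrite -subset0 => x [xr /has_occurs_bound /leq_trans /(_ gN)].
rewrite ltnNge => /negP[].
by case: xr => /=; [apply: occurs_swap | apply: has_occurs_swap].
Qed.

(** The chain keeps the weaker invariant [K] that some instance of the goal satisfies [J]; lifting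
    preserves it, and a choice of successors is iterated on goals bundled with a proof of [K]. *)
Lemma infinite_chain_invariant (J : seq (term S nat) -> Prop) g :
  (forall h, J h -> exists2 h', mstep h h' & J h') -> J g -> infinite_chain P g.
Proof.
move=> J_step Jg.
pose K h := exists eta, J (map (app_subst eta) h).
have K_step (h : {h | K h}) : {h' : {h | K h} | step P (sval h) (sval h')}.
  apply: cid; case: h => h [eta Jh] /=.
  have [h' /lift_mstep[h1 [d [s1 Eh]]] Jh'] := J_step _ Jh.
  have Kh1 : K h1 by exists d; rewrite Eh.
  by exists (exist _ h1 Kh1).
have Kg : K g.
  by exists (subst_id S); rewrite (eq_map (@app_id S)) map_id.
pose F h := sval (K_step h).
exists (fun i => sval (iter i F (exist _ g Kg))) => // i /=.
exact: svalP (K_step _).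
Qed.

End Lifting.

(** * Soundness of the unfoldings for matching steps *)

Section Soundness.
Variables (S : signature) (P : program S).
Implicit Types (r : brule S) (th eta : subst S).

Local Open Scope classical_set_scope.

(** The tail [ss'] may hold extra terms in front of [ss], left over from rule bodies; when the
    right-hand side is e, nothing may be left over. *)
Definition reaches r : Prop := forall th ss, exists ss',
  msteps P (goal_of (app_esubst th r.1) ++ ss) (goal_of (app_esubst th r.2) ++ ss')
  /\ (r.2 = None -> ss' = ss).

(** The first step is explicit: identity rules only satisfy [reaches], whereas an infinite chain
    needs progress. *)
Definition sound r : Prop := forall th ss, exists g1 ss',
  [/\ mstep P (goal_of (app_esubst th r.1) ++ ss) g1,
      msteps P g1 (goal_of (app_esubst th r.2) ++ ss')
    & r.2 = None -> ss' = ss].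

Lemma sound_reaches r : sound r -> reaches r.
Proof.
move=> sr th ss; have [g1 [ss' [s1 s2 E]]] := sr th ss.
by exists ss'; split=> //; apply: msteps_step s1 s2.
Qed.

Lemma reaches_refl (s : term S nat) : reaches (Some s, Some s).
Proof. by move=> th ss; exists ss; split=> //; apply: msteps_refl. Qed.

Lemma sound_renaming g r : sound r -> sound (rename_brule g r).
Proof.
move=> sr th ss; have [g1 [ss' [s1 s2 E]]] := sr (subst_comp g th) ss.
exists g1, ss'; rewrite /= -!app_esubst_comp; split=> // r2.
by apply: E; case: (r.2) r2.
Qed.

(** Each rule with right-hand side e erases the head of the goal and leaves the tail intact, so the
    body terms vanish one by one. *)
Lemma msteps_consume (us : seq (eterm S)) vs eta ss :
  (forall j, j < size us -> reaches (nth None us j, None)) ->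
  map (app_esubst eta) us = map (app_esubst eta) (map Some vs) ->
  msteps P (map (app_subst eta) vs ++ ss) ss.
Proof.
elim: us vs => [|u us IH] [|v vs] //= Rus; first by move=> _; apply: msteps_refl.
case=> Eu Eus; have [ss' [/= S1 Ess']] := Rus 0 isT eta (map (app_subst eta) vs ++ ss).
move: S1; rewrite Ess' // Eu /= => S1; apply: msteps_trans S1 _.
by apply: IH Eus => j; apply: (Rus j.+1).
Qed.

(** The step shared by both unfoldings: apply [(u, vs)] under [th] and [eta], erase the first
    [size us] body terms, then follow [(ui, v)]. The remaining body terms [vs2] join the tail. *)
Lemma sound_unfold u vs (us : seq (eterm S)) ui v th :
  P (u, vs) -> (size us < size vs)%N ->
  (forall j, (j < size us)%N -> reaches (nth None us j, None)) ->
  reaches (ui, v) ->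
  ((size us).+1 < size vs -> v <> None)%N ->
  unifier (rcons us ui) (map Some (take (size us).+1 vs)) th ->
  sound (Some (app_subst th u), app_esubst th v).
Proof.
move=> Pr szvs Rus Rui vN U eta ss.
pose vs1 := take (size us) vs; pose vs2 := drop (size us).+1 vs.
case: vs => [//|v0 vs'] in Pr szvs vN U vs1 vs2 *.
set vs := v0 :: vs' in Pr szvs vN U vs1 vs2 *.
pose vi := nth v0 vs (size us).
have Evs : vs = vs1 ++ vi :: vs2 by rewrite -drop_nth // cat_take_drop.
move: U; rewrite /unifier (take_nth v0) // !map_rcons => /rcons_inj[Eus Eui].
pose th' := subst_comp th eta.
exists (map (app_subst th') vs ++ ss).
have [ss' [S2 ss'E]] := Rui th' (map (app_subst th') vs2 ++ ss).
exists ss'; split.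
- by exists u, vs, th', ss; split=> //=; rewrite app_comp.
- rewrite Evs map_cat -catA.
  apply: (@msteps_trans _ _ _ (map (app_subst th') (vi :: vs2) ++ ss)).
    apply: (msteps_consume (us := us)) => //.
    rewrite (eq_map (app_esubst_comp th eta)) map_comp Eus -map_comp -map_comp -map_comp.
    by apply: eq_map => t /=; rewrite app_comp.
  move: S2; rewrite /= !(app_esubst_comp th eta) Eui /=.
  by rewrite -/vi app_comp.
(* If [v] is e, the unfolded position is the last one of the body, so [vs2] is empty. *)
move=> /= v_None; have {}v_None : v = None by case: (v) v_None.
rewrite ss'E //.
have -> : vs2 = [::]; last by [].
apply/nilP; rewrite /nilp /vs2 size_drop subn_eq0 leqNgt.
by apply/negP => /vN.
Qed.

Lemma fresh_nth (A : Type) (var : A -> set nat) (V : set nat) (U : set A) rs (r0 : A) j :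
  fresh var V U rs -> (j < size rs)%N -> U (nth r0 rs j).
Proof. by elim: rs V j => [|r rs IH] V [|j] //= [Ur _ /IH]; [move=> _|apply]. Qed.

Lemma fresh_rcons (A : Type) (var : A -> set nat) (V : set nat) (U : set A) rs (r : A) :
  fresh var V U (rcons rs r) -> U r /\ forall (r0 : A) j, (j < size rs)%N -> U (nth r0 rs j).
Proof.
move=> fr; split.
  have := @fresh_nth _ _ _ _ _ r (size rs) fr.
  by rewrite size_rcons ltnSn nth_rcons ltnn eqxx; apply.
move=> r0 j jrs; have := @fresh_nth _ _ _ _ _ r0 j fr.
by rewrite size_rcons nth_rcons jrs; apply; apply: ltnW.
Qed.

Lemma Tbeta_sound U : U `<=` sound -> Tbeta P U `<=` sound.
Proof.
move=> sU r.
have RU r' : (U `|` @id_rules S) r' -> reaches r'.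
  by case=> [/sU/sound_reaches//|[f [x [_ ->]]]]; apply: reaches_refl.
case=> -[r' H [g _ ->]]; apply: sound_renaming; move: H.
  case=> u Pu -> th ss; exists ss, ss; split=> //; last exact: msteps_refl.
  by exists u, [::], th, ss.
case=> u [vs] [us] [ui] [v] [th] [[Pr szvs] fr vN [Uth _] ->].
have [Rui Rus] := fresh_rcons fr.
apply: (sound_unfold (us := us) (vs := vs) (ui := ui)) => //; last exact: RU.
move=> j jus; have := Rus (None, None) j; rewrite size_map => /(_ jus)/RU.
by rewrite (nth_map None).
Qed.

Lemma binunf_sound : binunf P `<=` sound.
Proof.
move=> r [n _]; elim: n r => // n IH r /=; exact: Tbeta_sound.
Qed.

Definition psound (r : prule S) : Prop := rules r `<=` sound.

Lemma prenamings_sound U : U `<=` psound -> prenamings U `<=` psound.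
Proof.
move=> sU r [r0 /sU sr0 r_r0] b /r_r0[b0 /sr0 sb0 [g _ ->]].
exact: sound_renaming.
Qed.

Lemma commutes_app (sg sg' : subst S) t : commutes sg sg' ->
  app_subst sg' (app_subst sg t) = app_subst sg (app_subst sg' t).
Proof. by move=> C; rewrite /app_subst !bind_bind; apply: eq_bind. Qed.

Lemma commutes_pow (sg sg' : subst S) n : commutes sg sg' ->
  commutes (subst_pow sg n) sg'.
Proof.
move=> C x; elim: n => [|n IH] /=; first by rewrite app_id.
by rewrite commutes_app // IH app_comp.
Qed.

(** In postfix notation, commutation sorts [(sg' sg)^n] into [sg'^n sg^n]. *)
Lemma app_pow_comp (sg sg' : subst S) n t : commutes sg sg' ->
  app_subst (subst_pow (subst_comp sg' sg) n) t
  = app_subst (subst_pow sg n) (app_subst (subst_pow sg' n) t).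
Proof.
move=> C; elim: n => [|n IH] /=; first by rewrite !app_id.
by rewrite !app_comp IH (commutes_app _ (commutes_pow n C)).
Qed.

Lemma hat_inst (s : eterm S) n : pterm_inst (hat s) n = s.
Proof.
rewrite /pterm_inst /psubst_inst /=; case: s => //= t; congr Some.
by rewrite app_comp app_id; elim: n => [|n IH] /=; rewrite ?app_comp app_id.
Qed.

(** Both commutation conditions enter here: [(sgi sg)^n mui mu] becomes [sgi^n sg^n mui mu], then
    [sgi^n mui sg^n mu]. *)
Lemma comp_inst (v : eterm S) sgi mui sg mu n : commutes sg sgi -> commutes sg mui ->
  pterm_inst (v, (subst_comp sgi sg, subst_comp mui mu)) n
  = app_esubst (psubst_inst (sg, mu) n) (pterm_inst (v, (sgi, mui)) n).
Proof.
move=> C1 C2; rewrite /pterm_inst /psubst_inst /=; case: v => //= t; congr Some.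
by rewrite !app_comp app_pow_comp // (commutes_app _ (commutes_pow n C2)).
Qed.

(** At each fixed [n], a pattern unfolding is an ordinary one, with the [n]-th instance of the
    pattern mgu as unifier. *)
Lemma Tpi_sound B U : B `<=` psound -> U `<=` psound -> Tpi P B U `<=` psound.
Proof.
move=> sB sU r.
have RU (r' : prule S) n : (U `|` @patid S) r' -> reaches (pterm_inst r'.1 n, pterm_inst r'.2 n).
  case=> [/sU sr'|[f [x [_ ->]]]]; last by rewrite !hat_inst; apply: reaches_refl.
  by apply/sound_reaches/sr'; exists n.
case; apply: prenamings_sound => //.
move=> {}r [u] [vs] [ps] [pi] [v] [sgi] [mui] [sg] [mu].
case=> -[Pr szvs] fr vN [Umgu [C1 C2]] -> b [n _ <-].
have [Rpi Rps] := fresh_rcons fr.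
have [Uth _] := Umgu n.
rewrite comp_inst //=.
apply: (sound_unfold (us := [seq pterm_inst p n | p <- ps]) (vs := vs)
  (ui := pterm_inst pi n)) => //.
- by rewrite size_map.
- move=> j; rewrite size_map => jps.
  have := Rps (hat None, hat None) j; rewrite size_map => /(_ jps)/(RU _ n).
  by rewrite !(nth_map (hat None)) //= hat_inst.
- exact: RU Rpi.
- by rewrite size_map => /vN; rewrite /pterm_inst; case: (v).
rewrite size_map; move: Uth; rewrite map_rcons -map_comp.
by rewrite (eq_map (fun w => hat_inst (Some w) n)).
Qed.

Lemma patunf_sound B : correct_set P B -> patunf P B `<=` psound.
Proof.
move=> B_correct r [n _]; elim: n r => // n IH r /=.
apply: Tpi_sound => // {}r /B_correct cr b /cr; exact: binunf_sound.
Qed.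

End Soundness.

(** * Instances of special pattern rules *)

Section Special.
Variable S : signature.
Implicit Types (t : term S nat) (c : chi1 S) (p : pterm S).

Lemma nestS c n t : nest c n.+1 t = bind (fun=> nest c n t) (sval c).
Proof. by rewrite /nest /= /fill bind_bind. Qed.

Lemma nestD c m n t : nest c (m + n) t = nest c m (nest c n t).
Proof. by elim: m => [|m IH] //; rewrite addSn !nestS IH. Qed.

Lemma app_nest (th : subst S) c n t :
  app_subst th (nest c n t) = nest c n (app_subst th t).
Proof. by rewrite /app_subst /nest bind_bind. Qed.

Lemma uinst_bind_embed (V : Type) (th : V -> term (usig S) nat) (s : term S V) n :
  uinst (bind th (embed s)) n = bind (fun x => uinst (th x) n) s.
Proof.
elim/term_nested_ind: s => [x|f ts IH] //=.
rewrite /uinst /=; congr Fn; apply/ffunP => i; rewrite !ffunE.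
exact: IH.
Qed.

Lemma uinst_embed t n : uinst (embed t) n = t.
Proof. by rewrite -[embed t]bind_Var uinst_bind_embed bind_Var. Qed.

Lemma uinst_usymb c a b t n : uinst (usymb c a b (embed t)) n = nest c (a * n + b) t.
Proof. by rewrite /uinst /= !ffunE; congr nest; apply: uinst_embed. Qed.

Lemma pow_nest (sg : subst S) c a x n :
  sg x = nest c a (Var x) -> subst_pow sg n x = nest c (a * n) (Var x).
Proof.
move=> E; elim: n => [|n IH]; first by rewrite muln0.
by rewrite /= IH app_nest {1}/app_subst /= E -nestD mulnS addnC.
Qed.

Lemma pow_fix (sg : subst S) x n : sg x = Var x -> subst_pow sg n x = Var x.
Proof. by move=> E; elim: n => //= n ->. Qed.

(** On a variable of the base term, [sg^n] builds [c^(a n)] and [mu] adds [c^b], which is the height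
    [a n + b] encoded by the symbol for [c], [a], [b]. *)
Lemma upsilon_inst p u n : upsilon p u -> pterm_inst p n = Some (uinst u n).
Proof.
case: p => -[s|] [sg mu] [s' [th []]] //= [<-] thP <-.
rewrite /pterm_inst /=; congr Some; rewrite uinst_bind_embed.
apply: eq_in_bind => x xs; have [/= th1 th2] := thP x xs.
have [E|E] := pselect (sg x = Var x).
  by rewrite th1 // uinst_embed pow_fix.
have [c [a [b [t [Esg Emu ->]]]]] := th2 E.
by rewrite uinst_usymb (pow_nest _ Esg) app_nest {1}/app_subst /= Emu nestD.
Qed.

End Special.

Section SpecialRule.
Variables (S : signature) (p q : pterm S) (w : special (p, q)).

Local Open Scope classical_set_scope.

Definition special_lhs n : term S nat :=
  bind (fun i => nest (sp_ci i) (sp_ai i * n + sp_bi i) (sp_t i))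
    (sval (sp_c w)).

Lemma special_lhs_inst n : pterm_inst p n = Some (special_lhs n).
Proof.
rewrite (upsilon_inst n (sp_left w)) uinst_bind_embed; congr Some.
by apply: eq_bind => i; rewrite uinst_usymb.
Qed.

Lemma special_rhs_inst n : pterm_inst q n = Some
  (bind (fun i => nest (sp_ci i) (sp_ai' i * n + sp_bi' i)
                    (app_subst (sp_rho w) (sp_t i))) (sval (sp_c w))).
Proof.
rewrite (upsilon_inst n (sp_right w)) uinst_bind_embed; congr Some.
by apply: eq_bind => i; rewrite uinst_usymb.
Qed.

Lemma special_ground (i : 'I_(sp_m w)) : is_ground (sp_t i) ->
  [/\ sp_ai i = sp_h w, sp_ai' i = sp_h w, sp_bi i = sp_b w
    & sp_bi' i = sp_b' w].
Proof.
move=> gi.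
have : [set (sp_ai i, sp_ai' i) | i in [set i : 'I_(sp_m w) | is_ground (sp_t i)]]
    (sp_ai i, sp_ai' i) by exists i.
have : [set (sp_bi i, sp_bi' i) | i in [set i : 'I_(sp_m w) | is_ground (sp_t i)]]
    (sp_bi i, sp_bi' i) by exists i.
by rewrite sp_3ground sp_4ground => -[-> ->] [-> ->].
Qed.

Lemma special_var (i : 'I_(sp_m w)) : is_variable (sp_t i) ->
  [/\ sp_ai i = sp_a w, sp_ai' i = sp_a' w, sp_bi i = sp_d w
    & sp_bi' i = sp_d' w].
Proof.
move=> gi.
have : [set (sp_ai i, sp_ai' i) | i in [set i : 'I_(sp_m w) | is_variable (sp_t i)]]
    (sp_ai i, sp_ai' i) by exists i.
have : [set (sp_bi i, sp_bi' i) | i in [set i : 'I_(sp_m w) | is_variable (sp_t i)]]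
    (sp_bi i, sp_bi' i) by exists i.
by rewrite sp_3var sp_4var => -[-> ->] [-> ->].
Qed.

Definition holds_var x (i : 'I_(sp_m w)) :=
  if sp_t i is Var y then x == y else false.

Lemma holds_varP x i : reflect (sp_t i = Var x) (holds_var x i).
Proof.
rewrite /holds_var; case: (sp_t i) => [y|f ts]; last by right.
by apply: (iffP eqP) => [->|[->]].
Qed.

(** The substitution sends [x] to [e] copies of a context [c_i] around [x rho], where hole [i] is
    any one that holds [x]. *)
Lemma special_shift_fin e : exists D : seq nat, forall x, x \notin D ->
  (if [pick i | holds_var x i] is Some i
   then nest (sp_ci i) e (sp_rho w x) else Var x) = Var x.
Proof.
exists (pmap (fun i => if sp_t (i : 'I_(sp_m w)) is Var y then Some y else None) (enum 'I_(sp_m w))).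
move=> x xD; case: pickP => // i /holds_varP Ei.
case/negP: xD; rewrite mem_pmap; apply/mapP; exists i; first by rewrite mem_enum.
by rewrite Ei.
Qed.
Definition special_shift e : subst S := Subst (special_shift_fin e).

Lemma special_kE : sp_b' w = sp_h w * sp_k w + sp_b w.
Proof.
have h0 : ((sp_h w)%:R != 0 :> rat)%R by rewrite pnatr_eq0 -lt0n sp_3h.
have /(congr1 (fun z => z * (sp_h w)%:R)%R) := sp_5k w.
rewrite divfK // => /esym /eqP; rewrite subr_eq -natrM -natrD eqr_nat => /eqP ->.
by rewrite mulnC.
Qed.

(** Over ground terms the heights agree, as [h n + b' = h (n + k) + b]. Over variables the
    hypothesis makes the excess [e] a true difference of heights, and [eta] supplies the missing
    layers. *)
Lemma special_rhs_shift n :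
    sp_a w * (n + sp_k w) + sp_d w <= sp_a' w * n + sp_d' w ->
  exists eta, pterm_inst q n = Some (app_subst eta (special_lhs (n + sp_k w))).
Proof.
move=> le_n; pose e := sp_a' w * n + sp_d' w - (sp_a w * (n + sp_k w) + sp_d w).
exists (special_shift e); rewrite special_rhs_inst /special_lhs {2}/app_subst bind_bind.
congr Some; apply: eq_bind => i.
rewrite -[RHS]/(app_subst _ _) app_nest.
have [/[dup] /special_var[-> -> -> ->] [x Ex]|/[dup] /special_ground[-> -> -> ->] gi]
  := sp_1 i; last first.
  by rewrite !app_ground // special_kE mulnDr addnA.
(* The picked hole [j] may differ from [i], but it holds the same variable, so condition (2) gives
   the same context. *)
rewrite Ex {1 2}/app_subst /=; case: pickP => [j /holds_varP Ej|/(_ i)]; last first.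
  by move/holds_varP: Ex => ->.
have -> : sp_ci j = sp_ci i.
  by apply: sp_2; [exists x | rewrite Ej Ex].
by rewrite -nestD subnKC.
Qed.

(** For [a < a'], [alpha] is the threshold obtained by solving the inequality for [n]; for [a = a'],
    [n] cancels and condition (5) remains. *)
Lemma alpha_le n : (alpha w <= n%:R)%R ->
  sp_a w * (n + sp_k w) + sp_d w <= sp_a' w * n + sp_d' w.
Proof.
rewrite /alpha; case: eqP => [/[dup] ea <- _|/eqP ne].
  have := sp_5d ea; lia.
have lt_a : sp_a w < sp_a' w by rewrite ltn_neqAle ne sp_3a.
rewrite ler_pdivrMr ?subr_gt0 ?ltr_nat //.
rewrite lerBlDr mulrBr -!natrM => H.
rewrite -(ler_nat rat) mulnDr !natrD.
by move: H; rewrite !natrM; lra.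
Qed.

End SpecialRule.

(** * The infinite chain of a special pattern rule *)

Theorem theorem4p15 (S : signature) (P : program S) (B : set (prule S))
    (B_correct : correct_set P B) (p q : pterm S) (r_patunf : patunf P B (p, q))
    (w : special (p, q)) (n : nat) (n_ge : (alpha w <= n%:R)%R) (theta : subst S) :
  infinite_chain P (goal_of (app_esubst theta (pterm_inst p n))).
Proof.
have sr : psound P (p, q) := patunf_sound B_correct r_patunf.
pose ok n := sp_a w * (n + sp_k w) + sp_d w <= sp_a' w * n + sp_d' w.
(* Soundness yields several steps at a time, so the invariant also admits goals on the way to an
   instance of [p(n)]. *)
pose J h := exists n th ss,
  ok n /\ msteps P h (app_subst th (special_lhs w n) :: ss).
apply: (infinite_chain_invariant (J := J)); last first.
  exists n, theta, [::]; split; first exact: alpha_le.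
  by rewrite (special_lhs_inst w); apply: msteps_refl.
move=> h [m [th [ss [ok_m h_m]]]].
(* Raising [m] by [k] adds [a k] on the left and [a' k] on the right, and [a <= a']. *)
have ok_m' : ok (m + sp_k w).
  by move: ok_m (sp_3a w); rewrite /ok; nia.
have [eta Eq] := special_rhs_shift ok_m.
have [|g1 [ss' [s1 s2 _]]] := sr (pterm_inst p m, pterm_inst q m) _ th ss.
  by exists m.
rewrite /= (special_lhs_inst w) /= in s1.
rewrite /= Eq /= -app_comp in s2.
(* Either the instance of [p(m)] is reached and the first step given by soundness is taken, or a
   pending step is. In both cases the next target is an instance of [p(m + k)]. *)
have [Eh|[h1 hh1 h1m]] := msteps_inv h_m.
  rewrite Eh.
  by exists g1 => //; exists (m + sp_k w), (subst_comp eta th), ss'.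
exists h1 => //; exists (m + sp_k w), (subst_comp eta th), ss'; split=> //.
by apply: msteps_trans h1m _; apply: msteps_step s1 s2.
Qed.
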